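(* Let $f\colon\mathbb{R}^n\to\mathbb{R}$ be continuously differentiable, let $M\subset\mathbb{R}^n$ be closed, and let $K\colon\mathbb{R}^n\rightrightarrows\mathbb{R}^m$ be a set-valued mapping with closed graph. Consider $$(\mathrm P)\quad \min_z\{f(z)\mid z\in M\cap\operatorname{dom}K\},\qquad (\mathrm Q)\quad \min_{z,\lambda}\{f(z)\mid z\in M,\ (z,\lambda)\in\operatorname{gph}K\}.$$ Let $\bar z$ be a feasible point of $(\mathrm P)$ at which $K$ is inner semicompact w.r.t. $\operatorname{dom}K$. For $\bar\lambda\in K(\bar z)$ and $\kappa>0$ consider the inclusions $$(\mathrm I)\quad \widehat\partial\operatorname{dist}(\cdot,M\cap\operatorname{dom}K)(\bar z)\subset\kappa\bigl(\widehat\partial\operatorname{dist}(\cdot,M)(\bar z)+\widehat\partial\operatorname{dist}(\cdot,\operatorname{dom}K)(\bar z)\bigr),$$ $$(\mathrm E)\quad \widehat\partial\operatorname{dist}(\cdot,(M\times\mathbb{R}^m)\cap\operatorname{gph}K)(\bar z,\bar\lambda)\subset\kappa\bigl(\widehat\partial\operatorname{dist}(\cdot,M)(\bar z)\times\{0\}+\widehat\partial\operatorname{dist}(\cdot,\operatorname{gph}K)(\bar z,\bar\lambda)\bigr).$$ Then the following hold. (a) If $\bar z$ is an implicit local minimizer of $(\mathrm P)$ and if there exists $\kappa>0$ such that $(\mathrm I)$ holds, then $\bar z$ is implicitly S-stationary. (b) If, for some $\bar\lambda\in K(\bar z)$, $(\bar z,\bar\lambda)$ is a local minimizer of $(\mathrm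 Q)$ and if there exists $\kappa>0$ such that $(\mathrm E)$ holds, then $\bar z$ is explicitly S-stationary w.r.t. $\bar\lambda$. (c) If $\bar z$ is an explicit local minimizer of $(\mathrm P)$ and if, for each $\bar\lambda\in K(\bar z)$, there exists $\kappa>0$ such that $(\mathrm E)$ holds, then $\bar z$ is explicitly S-stationary.
   Context: $\operatorname{gph}K:=\{(z,\lambda)\mid\lambda\in K(z)\}$, $\operatorname{dom}K:=\{z\mid K(z)\neq\emptyset\}$; $\|\cdot\|$ is the Euclidean norm and $\operatorname{dist}(z,\Omega):=\inf_{z'\in\Omega}\|z'-z\|$. For $\Omega\subset\mathbb{R}^n$ locally closed around $\bar z\in\Omega$, the regular normal cone is $\widehat N_\Omega(\bar z):=\{\zeta\mid\zeta^\top(z-\bar z)\le o(\|z-\bar z\|)\ \forall z\in\Omega\}$. Regular subdifferential of a lower semicontinuous $\upsilon\colon\mathbb{R}^n\to\mathbb{R}$: $\widehat\partial\upsilon(\bar z):=\{\zeta\mid(\zeta,-1)\in\widehat N_{\operatorname{epi}\upsilon}(\bar z,\upsilon(\bar z))\}$, where $\operatorname{epi}\upsilon:=\{(z,\alpha)\mid\alpha\ge\upsilon(z)\}$. Regular coderivative: $\widehat D^*K(\bar z,\bar\lambda)(y^* ):=\{x^*\in\mathbb{R}^n\mid(x^*,-y^* )\in\widehat N_{\operatorname{gph}K}(\bar z,\bar\lambda)\}$. $K$ is inner semicompact w.r.t. $\operatorname{dom}K$ at $\bar z\in\operatorname{dom}K$ if for each sequence $\{z_k\}\subset\operatorname{dom}K$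 with $z_k\to\bar z$ there is a sequence $\{\lambda_k\}$ possessing a bounded subsequence such that $\lambda_k\in K(z_k)$ for all $k$. (This together with closedness of $\operatorname{gph}K$ makes $\operatorname{dom}K$ closed locally around $\bar z$.) An implicit local minimizer of $(\mathrm P)$ is a local minimizer of $(\mathrm P)$ in the usual sense. A feasible point $\bar z$ of $(\mathrm P)$ is an explicit local minimizer of $(\mathrm P)$ if $(\bar z,\bar\lambda)$ is a local minimizer of $(\mathrm Q)$ for each $\bar\lambda\in K(\bar z)$. Stationarity of $\bar z$: - implicitly S-stationary: $-\nabla f(\bar z)\in\widehat N_M(\bar z)+\widehat N_{\operatorname{dom}K}(\bar z)$; - explicitly S-stationary w.r.t. $\bar\lambda\in K(\bar z)$: $-\nabla f(\bar z)\in\widehat N_M(\bar z)+\widehat D^*K(\bar z,\bar\lambda)(0)$; - explicitly S-stationary: the preceding inclusion holds for all $\bar\lambda\in K(\bar z)$. *)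

(* Defs.v *)
From HB Require Import structures.
From mathcomp Require Import all_boot all_order all_algebra.
From mathcomp Require Import all_classical all_reals all_analysis.

Set Implicit Arguments.
Unset Strict Implicit.
Unset Printing Implicit Defensive.

Import Order.TTheory GRing.Theory Num.Theory.
Import numFieldNormedType.Exports.

Local Open Scope classical_set_scope.
Local Open Scope ring_scope.

(* R^n is 'rV[R]_n, whose library norm `|x| is the maximum norm; the Euclidean
   structure is therefore introduced separately. Both norms induce the topology
   of 'rV[R]_n used by closed, cvg, near and differentiable. R^n x R^m is
   'rV[R]_(n + m): a pair (z, l) is row_mx z l, with components lsubmx and
   rsubmx, so that it carries the Euclidean norm of the product. *)

Definition dotv (R : realType) (n : nat) (x y : 'rV[R]_n) : R :=
  \sum_(i < n) x 0 i * y 0 i.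

Definition enorm (R : realType) (n : nat) (x : 'rV[R]_n) : R :=
  Num.sqrt (dotv x x).

(* Only meaningful for nonempty A: inf set0 = 0 in the library. *)
Definition dist (R : realType) (n : nat) (A : set 'rV[R]_n) (z : 'rV[R]_n) : R :=
  inf [set enorm (z' - z) | z' in A].

Definition grad (R : realType) (n : nat) (f : 'rV[R]_n -> R) (z : 'rV[R]_n) :
    'rV[R]_n :=
  \row_(i < n) 'D_(delta_mx 0 i) f z.

Definition cont_differentiable (R : realType) (n : nat) (f : 'rV[R]_n -> R) : Prop :=
  (forall z, differentiable f z) /\ continuous (grad f).

Definition local_minimizer (R : realType) (n : nat) (f : 'rV[R]_n -> R)
    (A : set 'rV[R]_n) (zb : 'rV[R]_n) : Prop :=
  A zb /\ \forall z \near zb, A z -> f zb <= f z.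

Definition msum (R : realType) (n : nat) (A B : set 'rV[R]_n) : set 'rV[R]_n :=
  [set a + b | a in A & b in B].

Definition mscale (R : realType) (n : nat) (c : R) (A : set 'rV[R]_n) :
    set 'rV[R]_n :=
  [set c *: a | a in A].

(* Used at points zb of A only. *)
Definition regular_normal_cone (R : realType) (n : nat) (A : set 'rV[R]_n)
    (zb : 'rV[R]_n) : set 'rV[R]_n :=
  [set zeta | forall eps : R, 0 < eps ->
    \forall z \near zb, A z -> dotv zeta (z - zb) <= eps * enorm (z - zb)].

Definition epi (R : realType) (n : nat) (v : 'rV[R]_n -> R) : set 'rV[R]_(n + 1) :=
  [set w | v (lsubmx w) <= rsubmx w 0 0].

(* c%:M : 'rV[R]_1 is the scalar c seen as an element of R^1. *)
Definition regular_subdifferential (R : realType) (n : nat) (v : 'rV[R]_n -> R)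
    (zb : 'rV[R]_n) : set 'rV[R]_n :=
  [set zeta | regular_normal_cone (epi v) (row_mx zb (v zb)%:M)
                (row_mx zeta (-1)%:M)].

Section SetValuedMappings.
Context (R : realType) (n m : nat).
Implicit Types (K : 'rV[R]_n -> set 'rV[R]_m) (M : set 'rV[R]_n).

Definition gph K : set 'rV[R]_(n + m) := [set w | K (lsubmx w) (rsubmx w)].

Definition dom K : set 'rV[R]_n := [set z | K z !=set0].

Definition regular_coderivative K (zb : 'rV[R]_n) (lb : 'rV[R]_m)
    (ys : 'rV[R]_m) : set 'rV[R]_n :=
  [set xs | regular_normal_cone (gph K) (row_mx zb lb) (row_mx xs (- ys))].

Definition inner_semicompact_dom K (zb : 'rV[R]_n) : Prop :=
  forall z_ : nat -> 'rV[R]_n,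
    (forall k, dom K (z_ k)) -> z_ @ \oo --> zb ->
    exists l_ : nat -> 'rV[R]_m,
      (forall k, K (z_ k) (l_ k)) /\
      exists phi : nat -> nat, {homo phi : i j / (i < j)%N} /\
        exists B : R, forall k, enorm (l_ (phi k)) <= B.

Definition feasible_P M K : set 'rV[R]_n := M `&` dom K.

(* (M x R^m) /\ gph K *)
Definition feasible_Q M K : set 'rV[R]_(n + m) := lsubmx @^-1` M `&` gph K.

Definition implicit_local_minimizer (f : 'rV[R]_n -> R) M K (zb : 'rV[R]_n) : Prop :=
  local_minimizer f (feasible_P M K) zb.

Definition local_minimizer_Q (f : 'rV[R]_n -> R) M K (zb : 'rV[R]_n)
    (lb : 'rV[R]_m) : Prop :=
  local_minimizer (f \o lsubmx) (feasible_Q M K) (row_mx zb lb).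

Definition explicit_local_minimizer (f : 'rV[R]_n -> R) M K (zb : 'rV[R]_n) : Prop :=
  feasible_P M K zb /\ forall lb, K zb lb -> local_minimizer_Q f M K zb lb.

Definition implicitly_S_stationary (f : 'rV[R]_n -> R) M K (zb : 'rV[R]_n) : Prop :=
  msum (regular_normal_cone M zb) (regular_normal_cone (dom K) zb) (- grad f zb).

Definition explicitly_S_stationary_wrt (f : 'rV[R]_n -> R) M K (zb : 'rV[R]_n)
    (lb : 'rV[R]_m) : Prop :=
  msum (regular_normal_cone M zb) (regular_coderivative K zb lb 0) (- grad f zb).

Definition explicitly_S_stationary (f : 'rV[R]_n -> R) M K (zb : 'rV[R]_n) : Prop :=
  forall lb, K zb lb -> explicitly_S_stationary_wrt f M K zb lb.

Definition inclusion_I M K (zb : 'rV[R]_n) (kappa : R) : Prop :=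
  regular_subdifferential (dist (feasible_P M K)) zb `<=`
  mscale kappa (msum (regular_subdifferential (dist M) zb)
                     (regular_subdifferential (dist (dom K)) zb)).

Definition inclusion_E M K (zb : 'rV[R]_n) (lb : 'rV[R]_m) (kappa : R) : Prop :=
  regular_subdifferential (dist (feasible_Q M K)) (row_mx zb lb) `<=`
  mscale kappa
    (msum [set row_mx zeta (0 : 'rV[R]_m) | zeta in regular_subdifferential (dist M) zb]
          (regular_subdifferential (dist (gph K)) (row_mx zb lb))).

End SetValuedMappings.

(* Main.v *)
Require Import Defs.
From mathcomp Require Import all_boot all_order all_algebra.
From mathcomp Require Import all_classical all_reals all_analysis.
From mathcomp Require Import lra ring.
Set Implicit Arguments.
Unset Strict Implicit.
Unset Printing Implicit Defensive.

Import Order.TTheory GRing.Theory Num.Theory.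
Import numFieldNormedType.Exports.
Local Open Scope classical_set_scope.
Local Open Scope ring_scope.

(** The distance function to a set A is a calculus-friendly substitute for the
    normal cone of A: at a point z of A, its regular subdifferential is the
    intersection of the regular normal cone of A with the closed Euclidean unit
    ball. Two halves of this fact are used. Subgradients are normals because
    the distance vanishes on A ([subdifferential_dist_normal]). Conversely a
    normal zeta of norm at most 1 is a subgradient: for y near z and an almost
    nearest point p of A, write y - z = (y - p) + (p - z); the first part costs
    at most the distance of y to A, since zeta has norm at most 1, and the
    second part is of lower order, since zeta is normal
    ([normal_subdifferential_dist]).

    At a local minimizer, Fermat's rule says that the negative gradient is a
    regular normal of the feasible set ([local_minimizer_normal] for (P) and
    [local_minimizer_lsubmx_normal] for (Q)). Scaling it by some t > 0 brings
    it into the unit ball, hence into the subdifferential of the distance to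
    the feasible set. There the assumed inclusion splits it, up to the factor
    kappa, into subgradients of the distances to the two sets, which are
    normals of these sets. Multiplying back by kappa / t is harmless, since
    normals form cones, and gives S-stationarity. In case (b), the part of the
    gradient of (z, l) |-> f z along l is 0 and so is that of the normal coming
    from M; therefore the normal of the graph has the form (b, 0), which is
    exactly membership of b in the coderivative at 0. Case (c) is (b) at every
    element of K zb. *)

(** * Euclidean norm and the topology of row vectors *)

Section Euclidean.
Context {R : realType}.

Lemma dotvC n (x y : 'rV[R]_n) : dotv x y = dotv y x.
Proof. by apply: eq_bigr => i _; rewrite mulrC. Qed.

Lemma dotvDr n (x y z : 'rV[R]_n) : dotv x (y + z) = dotv x y + dotv x z.
Proof. by rewrite /dotv -big_split; apply: eq_bigr => i _; rewrite mxE mulrDr. Qed.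

Lemma dotvZr n (c : R) (x y : 'rV[R]_n) : dotv x (c *: y) = c * dotv x y.
Proof. by rewrite /dotv big_distrr; apply: eq_bigr => i _; rewrite mxE mulrCA. Qed.

Lemma dotvDl n (x y z : 'rV[R]_n) : dotv (x + y) z = dotv x z + dotv y z.
Proof. by rewrite dotvC dotvDr !(dotvC z). Qed.

Lemma dotvZl n (c : R) (x y : 'rV[R]_n) : dotv (c *: x) y = c * dotv x y.
Proof. by rewrite dotvC dotvZr dotvC. Qed.

Lemma dotvNl n (x y : 'rV[R]_n) : dotv (- x) y = - dotv x y.
Proof. by rewrite -scaleN1r dotvZl mulN1r. Qed.

Lemma dotv0r n (x : 'rV[R]_n) : dotv x 0 = 0.
Proof. by rewrite -(scale0r 0) dotvZr mul0r. Qed.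

Lemma dotv0l n (x : 'rV[R]_n) : dotv 0 x = 0.
Proof. by rewrite dotvC dotv0r. Qed.

Lemma dotv_ge0 n (x : 'rV[R]_n) : 0 <= dotv x x.
Proof. by apply: sumr_ge0 => i _; rewrite -expr2 sqr_ge0. Qed.

Lemma dotv_row_mx n m (a c : 'rV[R]_n) (b d : 'rV[R]_m) :
  dotv (row_mx a b) (row_mx c d) = dotv a c + dotv b d.
Proof.
rewrite /dotv big_split_ord; congr (_ + _); apply: eq_bigr => i _.
  by rewrite !row_mxEl.
by rewrite !row_mxEr.
Qed.

Lemma enorm_ge0 n (x : 'rV[R]_n) : 0 <= enorm x.
Proof. exact: sqrtr_ge0. Qed.

Lemma enorm_sqr n (x : 'rV[R]_n) : enorm x ^+ 2 = dotv x x.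
Proof. by rewrite sqr_sqrtr ?dotv_ge0. Qed.

Lemma enormZ n (c : R) (x : 'rV[R]_n) : 0 <= c -> enorm (c *: x) = c * enorm x.
Proof.
move=> c0; rewrite /enorm dotvZl dotvZr mulrA -expr2 sqrtrM ?sqr_ge0 // sqrtr_sqr.
by rewrite ger0_norm.
Qed.

Lemma enorm0 n : enorm (0 : 'rV[R]_n) = 0.
Proof. by rewrite -(scale0r 0) enormZ ?mul0r. Qed.

Lemma enormN n (x : 'rV[R]_n) : enorm (- x) = enorm x.
Proof. by rewrite /enorm -scaleN1r dotvZl dotvZr !mulN1r opprK. Qed.

Lemma enorm_row_mx0 n m (x : 'rV[R]_n) : enorm (row_mx x (0 : 'rV[R]_m)) = enorm x.
Proof.
by rewrite /enorm dotv_row_mx dotv0r addr0.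
Qed.

Lemma enorm_lsubmx n m (w : 'rV[R]_(n + m)) : enorm (lsubmx w) <= enorm w.
Proof.
by apply: ler_wsqrtr; rewrite -[w in leRHS]hsubmxK dotv_row_mx lerDl dotv_ge0.
Qed.

Lemma normr_le_enorm n (x : 'rV[R]_n) : `|x| <= enorm x.
Proof.
rewrite [leLHS]/Num.norm /= mx_normrE; apply: bigmax_le; first exact: enorm_ge0.
move=> [i j] _ /=; rewrite ord1 -sqrtr_sqr ler_wsqrtr// /dotv (bigD1 j) //= -expr2.
by rewrite lerDl sumr_ge0 // => k _; rewrite -expr2 sqr_ge0.
Qed.

Lemma enorm_eq0 n (x : 'rV[R]_n) : enorm x = 0 -> x = 0.
Proof. by move=> x0; apply/eqP; rewrite -normr_le0 -x0 normr_le_enorm. Qed.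

Lemma enorm_le_normr n (x : 'rV[R]_n) : enorm x <= n.+1%:R * `|x|.
Proof.
rewrite -(@ler_pXn2r _ 2) ?nnegrE ?enorm_ge0 ?mulr_ge0 // enorm_sqr.
have xi i : x 0 i * x 0 i <= `|x| ^+ 2.
  rewrite -expr2 -real_normK ?num_real // lerXn2r ?nnegrE //.
  by rewrite [leRHS]/Num.norm /= mx_normrE; apply/bigmax_geP; right; exists (0, i).
apply: le_trans (ler_sum _ (fun i _ => xi i)) _.
rewrite sumr_const card_ord -[leLHS]mulr_natl exprMn ler_wpM2r ?exprn_ge0 //.
by rewrite -natrX ler_nat -mulnn (leq_trans (leqnSn n)) ?leq_pmulr.
Qed.

(** Cauchy-Schwarz, from the nonnegativity of the squared norm of
    |y| x - |x| y, which equals 2 |x| |y| (|x| |y| - <x, y>). *)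
Lemma dotv_le_enorm n (x y : 'rV[R]_n) : dotv x y <= enorm x * enorm y.
Proof.
set a := enorm x; set b := enorm y.
have a0 : 0 <= a by exact: enorm_ge0.
have b0 : 0 <= b by exact: enorm_ge0.
have [/enorm_eq0 ->|an0] := eqVneq a 0.
  by rewrite dotv0l mulr_ge0.
have [/enorm_eq0 ->|bn0] := eqVneq b 0.
  by rewrite dotv0r mulr_ge0.
have ab0 : 0 < a * b by rewrite mulr_gt0 // lt0r ?an0 ?bn0.
have := dotv_ge0 (b *: x + (- a) *: y).
rewrite !(dotvDl, dotvDr, dotvZl, dotvZr) -!enorm_sqr -/a -/b (dotvC y x) => h.
rewrite -subr_ge0 -(pmulr_rge0 _ ab0); lra.
Qed.

Lemma ler_enormD n (x y : 'rV[R]_n) : enorm (x + y) <= enorm x + enorm y.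
Proof.
rewrite -(@ler_pXn2r _ 2) ?nnegrE ?addr_ge0 ?enorm_ge0 //.
rewrite enorm_sqr !(dotvDl, dotvDr) -!enorm_sqr (dotvC y x) sqrrD.
have := dotv_le_enorm x y; lra.
Qed.

(** Neighbourhoods of row vectors come from the maximum norm; its equivalence
    with the Euclidean norm turns every filter statement below into an explicit
    Euclidean radius. *)
Lemma near_enormP n (x : 'rV[R]_n) (P : set 'rV[R]_n) :
  (\forall y \near x, P y) <->
  exists2 d : R, 0 < d & forall y, enorm (y - x) < d -> P y.
Proof.
split=> [/nbhs_normP[d /= d0 dP]|[d d0 dP]].
  exists d => // y yd; apply: dP => /=.
  by rewrite distrC (le_lt_trans _ yd) // normr_le_enorm.
apply/nbhs_normP; exists (d / n.+1%:R) => /=; first by rewrite divr_gt0.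
move=> y /=; rewrite distrC ltr_pdivlMr // mulrC => yd; apply: dP.
exact: le_lt_trans (enorm_le_normr _) yd.
Qed.

End Euclidean.

(** * Normals and subgradients of distance functions *)

Section Normals.
Context {R : realType} {n : nat}.
Implicit Types (A : set 'rV[R]_n) (z zeta : 'rV[R]_n).

Lemma regular_normal_coneZ A z zeta (c : R) : 0 <= c ->
  regular_normal_cone A z zeta -> regular_normal_cone A z (c *: zeta).
Proof.
move=> c0 h eps eps0.
(* c may be 0, hence the division by c + 1. *)
have c1 : 0 < c + 1 by rewrite ltr_wpDl.
have := h (eps / (c + 1)) (divr_gt0 eps0 c1).
apply: filterS => y hy /hy {}hy; rewrite dotvZl.
apply: le_trans (ler_wpM2l c0 hy) _.
rewrite mulrA ler_wpM2r ?enorm_ge0 // mulrCA ger_pMr //.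
by rewrite ler_pdivrMr // mul1r lerDl.
Qed.

Lemma dist_has_lbound A z : has_lbound [set enorm (z' - z) | z' in A].
Proof. by exists 0 => _ [z' _ <-]; exact: enorm_ge0. Qed.

Lemma dist_ge0 A z : A !=set0 -> 0 <= dist A z.
Proof.
move=> [a Aa]; apply: lb_le_inf; first by exists (enorm (a - z)), a.
by move=> _ [z' _ <-]; exact: enorm_ge0.
Qed.

Lemma dist_eq0 A z : A z -> dist A z = 0.
Proof.
move=> Az; apply/eqP; rewrite eq_le dist_ge0 ?andbT; last by exists z.
by apply: ge_inf; [exact: dist_has_lbound | exists z; rewrite // subrr enorm0].
Qed.

Lemma dist_le A z a : A a -> dist A z <= enorm (a - z).
Proof. by move=> Aa; apply: ge_inf; [exact: dist_has_lbound | exists a]. Qed.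

Lemma dist_adherent A z (eps : R) : A !=set0 -> 0 < eps ->
  exists2 a, A a & enorm (a - z) < dist A z + eps.
Proof.
move=> [a Aa] eps0.
have hi : has_inf [set enorm (z' - z) | z' in A].
  by split; [exists (enorm (a - z)), a | exact: dist_has_lbound].
by have [_ [b Ab <-] lt] := inf_adherent eps0 hi; exists b.
Qed.

(** For y in A, the point (y, 0) lies in the epigraph of the distance to A, so
    testing the epigraphical normal (zeta, -1) there only leaves zeta. *)
Lemma subdifferential_dist_normal A z zeta : A z ->
  regular_subdifferential (dist A) z zeta -> regular_normal_cone A z zeta.
Proof.
move=> Az h eps eps0; have /near_enormP[d d0 dP] := h eps eps0.
apply/near_enormP; exists d => // y yd Ay.
have E : row_mx y (dist A z)%:M - row_mx z (dist A z)%:M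
    = row_mx (y - z) (0 : 'rV[R]_1).
  by rewrite opp_row_mx add_row_mx subrr.
have := dP (row_mx y (dist A z)%:M); rewrite E enorm_row_mx0 dotv_row_mx dotv0r addr0.
by apply=> //; rewrite /epi /= row_mxKl row_mxKr mxE eqxx mulr1n !dist_eq0.
Qed.

(** An almost nearest point of A is enough: its defect is allowed to be
    proportional to the distance r of the epigraph point to (z, 0), and
    is then absorbed in the error term. *)
Lemma normal_subdifferential_dist A z zeta : A z -> enorm zeta <= 1 ->
  regular_normal_cone A z zeta -> regular_subdifferential (dist A) z zeta.
Proof.
move=> Az zeta1 h eps eps0; rewrite dist_eq0 //.
(* The final error is 4 e r: e r from the choice of p and at most 3 e r from
   normality at p, which lies within 3 r of z. *)
pose e := Num.min eps 1 / 4.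
have e0 : 0 < e by rewrite divr_gt0 // lt_min eps0 /=.
have min1 : Num.min eps 1 <= 1 by rewrite ge_min lexx orbT.
have mineps : Num.min eps 1 <= eps by rewrite ge_min lexx.
have e1 : e <= 1 by rewrite /e; lra.
have ee : 4 * e <= eps by rewrite /e; lra.
have /near_enormP[d d0 dP] := h e e0.
(* With r < d / 4, the bound 3 r on the distance from p to z stays below d. *)
apply/near_enormP; exists (d / 4) => [|w]; first by rewrite divr_gt0.
rewrite -[w]hsubmxK /epi /= row_mxKl row_mxKr.
set y := lsubmx w; set al := rsubmx w.
set r := enorm _ => rd yal.
have yr : enorm (y - z) <= r.
  by apply: le_trans (enorm_lsubmx _); rewrite opp_row_mx add_row_mx row_mxKl.
have r0 : 0 <= r by exact: enorm_ge0.
(* For r = 0 the tolerance e r of the almost nearest point would vanish. *)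
have [r_eq0|r_neq0] := eqVneq r 0.
  have -> : row_mx y al - row_mx z 0%:M = 0.
    exact: enorm_eq0.
  by rewrite r_eq0 mulr0 dotv0r.
have rgt0 : 0 < r by rewrite lt0r r_neq0.
have [p Ap ltp] : exists2 p, A p & enorm (p - y) < dist A y + e * r.
  by apply: dist_adherent; [exists z | rewrite mulr_gt0].
have dr : dist A y <= r.
  by apply: le_trans yr; rewrite -[enorm (y - z)]enormN opprB dist_le.
have er : e * r <= r by rewrite ler_piMl.
have pz : enorm (p - z) <= 3 * r.
  have := ler_enormD (p - y) (y - z); rewrite addrA subrK; lra.
have dotp : dotv zeta (p - z) <= e * enorm (p - z) by apply: dP => //; lra.
have dotp' : e * enorm (p - z) <= 3 * (e * r).
  by rewrite (mulrCA 3) ler_wpM2l // ltW.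
have doty : dotv zeta (y - p) <= enorm (p - y).
  apply: le_trans (dotv_le_enorm _ _) _; rewrite -(enormN (p - y)) opprB.
  by rewrite ler_piMl ?enorm_ge0.
have er4 : 4 * e * r <= eps * r by rewrite ler_wpM2r.
rewrite opp_row_mx add_row_mx dotv_row_mx.
have -> : dotv zeta (y - z) = dotv zeta (y - p) + dotv zeta (p - z).
  by rewrite -dotvDr addrA subrK.
have -> : dotv (-1)%:M (al - 0%:M) = - al 0 0.
  rewrite /dotv big_ord1 !mxE eqxx !mulr1n; ring.
lra.
Qed.

(** The subdifferential only sees normals in the unit ball; since normals form a
    cone, dividing by 1 + |zeta| loses nothing and also covers zeta = 0. *)
Lemma normal_scaled_subdifferential A z zeta : A z ->
  regular_normal_cone A z zeta ->
  exists2 t : R, 0 < t & regular_subdifferential (dist A) z (t *: zeta).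
Proof.
move=> Az h; have c0 : 0 < enorm zeta + 1 by rewrite ltr_wpDl ?enorm_ge0.
exists (enorm zeta + 1)^-1; first by rewrite invr_gt0.
have t0 : 0 <= (enorm zeta + 1)^-1 by rewrite invr_ge0 ltW.
apply: normal_subdifferential_dist => //; last exact: regular_normal_coneZ.
by rewrite enormZ // mulrC ler_pdivrMr // mul1r lerDl.
Qed.

Lemma diff_grad (f : 'rV[R]_n -> R) z v : differentiable f z ->
  'd f z v = dotv (grad f z) v.
Proof.
move=> df; rewrite {1}[v]row_sum_delta linear_sum; apply: eq_bigr => i _.
by rewrite linearZ /= mxE deriveE // mulrC.
Qed.

Lemma differentiable_first_order (f : 'rV[R]_n -> R) z (eps : R) :
  differentiable f z -> 0 < eps ->
  \forall y \near z, f y - f z <= dotv (grad f z) (y - z) + eps * enorm (y - z).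
Proof.
move=> df eps0.
have /eqaddoP/(_ eps eps0) := diff_locally df.
move=> /near_enormP[d d0 dP]; apply/near_enormP; exists d => // y yd.
have := dP (y - z); rewrite subr0 => /(_ yd).
rewrite !fctE /= subrK diff_grad // => hy.
have := le_trans (ler_norm _) hy.
have := ler_wpM2l (ltW eps0) (normr_le_enorm (y - z)); rewrite /cst; lra.
Qed.

End Normals.

(** * Fermat's rule and S-stationarity *)

Lemma local_minimizer_normal {R : realType} {n : nat} (f : 'rV[R]_n -> R) A z :
  differentiable f z -> local_minimizer f A z ->
  regular_normal_cone A z (- grad f z).
Proof.
move=> df [_ fmin] eps eps0.
apply: filterS2 fmin (differentiable_first_order df eps0) => y hmin h2 /hmin h1.
rewrite dotvNl; lra.
Qed.

(** The first-order expansion of f is pulled back along the projection, which is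
    1-Lipschitz, so its remainder is still controlled by the distance in the
    product space. *)
Lemma local_minimizer_lsubmx_normal {R : realType} {n m : nat}
    (f : 'rV[R]_n -> R) (A : set 'rV[R]_(n + m)) w :
  differentiable f (lsubmx w) -> local_minimizer (f \o lsubmx) A w ->
  regular_normal_cone A w (row_mx (- grad f (lsubmx w)) 0).
Proof.
move=> df [_ fmin] eps eps0.
have /near_enormP[d d0 dP] := differentiable_first_order df eps0.
have near_d : \forall u \near w, enorm (u - w) < d by apply/near_enormP; exists d.
apply: filterS2 fmin near_d => u hmin ud /hmin /= h1.
have luw : lsubmx (u - w) = lsubmx u - lsubmx w by rewrite linearB.
have le_uw : enorm (lsubmx u - lsubmx w) <= enorm (u - w).
  by rewrite -luw enorm_lsubmx.
have h2 := dP _ (le_lt_trans le_uw ud).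
have h3 := ler_wpM2l (ltW eps0) le_uw.
rewrite -[u - w]hsubmxK dotv_row_mx luw dotvNl dotv0l addr0 -luw hsubmxK luw; lra.
Qed.

Theorem theorem4p13 (R : realType) (n m : nat) (f : 'rV[R]_n -> R)
    (M : set 'rV[R]_n) (K : 'rV[R]_n -> set 'rV[R]_m) (zb : 'rV[R]_n)
    (f_C1 : cont_differentiable f) (M_closed : closed M)
    (gphK_closed : closed (gph K)) (zb_feasible : feasible_P M K zb)
    (K_isc : inner_semicompact_dom K zb) :
  [/\ (implicit_local_minimizer f M K zb ->
       (exists kappa : R, 0 < kappa /\ inclusion_I M K zb kappa) ->
       implicitly_S_stationary f M K zb),
      (forall lb : 'rV[R]_m, K zb lb ->
       local_minimizer_Q f M K zb lb ->
       (exists kappa : R, 0 < kappa /\ inclusion_E M K zb lb kappa) ->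
       explicitly_S_stationary_wrt f M K zb lb)
    & (explicit_local_minimizer f M K zb ->
       (forall lb : 'rV[R]_m, K zb lb ->
        exists kappa : R, 0 < kappa /\ inclusion_E M K zb lb kappa) ->
       explicitly_S_stationary f M K zb)].
Proof.
have [df _] := f_C1; have [Mzb domzb] := zb_feasible.
have explicit lb : K zb lb -> local_minimizer_Q f M K zb lb ->
    (exists kappa : R, 0 < kappa /\ inclusion_E M K zb lb kappa) ->
    explicitly_S_stationary_wrt f M K zb lb.
  move=> Klb fmin [kappa [kappa0 incl]].
  have gphzb : gph K (row_mx zb lb) by rewrite /gph /= row_mxKl row_mxKr.
  have := local_minimizer_lsubmx_normal (df _) fmin; rewrite row_mxKl => normal.
  have [t t0 /incl] := normal_scaled_subdifferential fmin.1 normal.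
  move=> [_ [_ [a ha <-] [w hw <-]] eq_aw].
  have c0 : 0 <= t^-1 * kappa by rewrite ltW // mulr_gt0 ?invr_gt0.
  (* The second components force the normal u of the graph to be (b, 0). *)
  have {eq_aw} : row_mx (- grad f zb) 0 =
      (t^-1 * kappa) *: row_mx a 0 + (t^-1 * kappa) *: w.
    by rewrite -scalerDr -scalerA eq_aw scalerA mulVf ?scale1r ?gt_eqF.
  have := regular_normal_coneZ c0 (subdifferential_dist_normal gphzb hw).
  move: (_ *: w) => u hu; rewrite -[u in _ = _ + u]hsubmxK.
  rewrite scale_row_mx add_row_mx scaler0 add0r => /eq_row_mx[eq_l eq_r].
  exists ((t^-1 * kappa) *: a).
    exact: regular_normal_coneZ c0 (subdifferential_dist_normal Mzb ha).
  exists (lsubmx u); last by [].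
  by rewrite /regular_coderivative /= oppr0 eq_r hsubmxK.
split=> //; last first.
  by move=> [_ fmin] incl lb Klb; apply: explicit => //; [apply: fmin|apply: incl].
move=> fmin [kappa [kappa0 incl]].
have [t t0 /incl] :=
  normal_scaled_subdifferential zb_feasible (local_minimizer_normal (df _) fmin).
move=> [_ [a ha [b hb <-]] eq_ab].
have c0 : 0 <= t^-1 * kappa by rewrite ltW // mulr_gt0 ?invr_gt0.
exists ((t^-1 * kappa) *: a).
  exact: regular_normal_coneZ c0 (subdifferential_dist_normal Mzb ha).
exists ((t^-1 * kappa) *: b).
  exact: regular_normal_coneZ c0 (subdifferential_dist_normal domzb hb).
by rewrite -scalerDr -scalerA eq_ab scalerA mulVf ?scale1r ?gt_eqF.
Qed.
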